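(* Let $q\ge1$ be an integer, let $x$ be a real number, and let $\beta$ be a real number such that none of the numbers $\frac hq+\beta$, $h=0,1,\dots,q-1$, is a nonpositive integer. Then $$\left.\frac{\partial E_{\alpha,\beta}(x)}{\partial\alpha}\right|_{\alpha=1/q}=-\sum_{h=0}^{q-1}\frac{h\left[\psi\left(\frac hq+\beta\right)+Q\left(\frac hq+\beta,\;x^q\right)\right]+q\,x^q\,P\left(\frac hq+\beta,\;x^q\right)}{\Gamma\left(\frac hq+\beta\right)}\,x^h.$$
   Context: The two-parameter Mittag-Leffler function is $E_{\alpha,\beta}(x)=\sum_{k=0}^\infty\frac{x^k}{\Gamma(\alpha k+\beta)}$ (with $1/\Gamma=0$ at the poles of $\Gamma$, and $x^0=1$). The digamma function is $\psi=\Gamma'/\Gamma$ and $(a)_k=a(a+1)\cdots(a+k-1)$ is the Pochhammer symbol. For $a\notin\{0,-1,-2,\dots\}$ the functions $Q$ and $P$ are $$Q(a,x):=\sum_{k=1}^\infty\frac{x^k}{(a)_k}\psi(k+a)=e^x\left[x^{1-a}\psi(a)\gamma(a,x)+\frac{x}{a^2}\,{}_2F_2\left(a,a;a+1,a+1;-x\right)\right],$$ $$P(a,x):=\frac{\partial Q(a,x)}{\partial x}=\psi(a)+e^x\left\{\frac{x-a+1}{a^2}\,{}_2F_2\left(a,a;a+1,a+1;-x\right)+x^{-a}\gamma(a,x)\left[(x-a+1)\psi(a)+1\right]\right\},$$ where $\gamma(a,x)=\int_0^x e^{-t}t^{a-1}dt$ is the lower incomplete gamma function (analytically continued in $a$;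 $x^{-a}\gamma(a,x)=\sum_{j\ge0}\frac{(-x)^j}{j!(a+j)}$ is entire in $x$) and ${}_2F_2$ is the generalized hypergeometric function. *)

(* Defs.v *)
From Stdlib Require Export Reals.
From Coquelicot Require Export Coquelicot.
Open Scope R_scope.

(* (a)_k = a (a+1) ... (a+k-1), with (a)_0 = 1. *)
Fixpoint pochhammer (a : R) (k : nat) : R :=
  match k with
  | O => 1
  | S j => pochhammer a j * (a + INR j)
  end.

(* Euler's integral of the second kind; meaningful for x > 0 only. *)
Definition euler_integral (x : R) : R :=
  RInt_gen (fun t : R => Rpower t (x - 1) * exp (- t))
    (at_right 0) (Rbar_locally p_infty).

(* The least natural number n with x + n > 0; it is 0 when x > 0, since
   up (- x) is the least integer greater than - x. *)
Definition gamma_shift (x : R) : nat := Z.to_nat (up (- x)).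

(* The Gamma function on the real line, extended to nonpositive arguments by
   Gamma (x + n) = (x)_n Gamma x.  Its value at the poles 0, -1, -2, ... is
   irrelevant. *)
Definition Gamma (x : R) : R :=
  euler_integral (x + INR (gamma_shift x)) / pochhammer x (gamma_shift x).

(* The entire function 1 / Gamma.  At a pole of Gamma the Pochhammer symbol
   vanishes, so that 1 / Gamma = 0 there. *)
Definition rGamma (x : R) : R :=
  pochhammer x (gamma_shift x) / euler_integral (x + INR (gamma_shift x)).

Definition digamma (x : R) : R := Derive Gamma x / Gamma x.

(* pow gives x ^ 0 = 1 also at x = 0. *)
Definition mittag_leffler (alpha beta x : R) : R :=
  Series (fun k : nat => x ^ k * rGamma (alpha * INR k + beta)).

(* The sum over k >= 1 is reindexed by k = S j. *)
Definition Q (a x : R) : R :=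
  Series (fun j : nat =>
    x ^ S j / pochhammer a (S j) * digamma (INR (S j) + a)).

Definition P (a x : R) : R := Derive (fun y : R => Q a y) x.

Definition nonpositive_integer (x : R) : Prop := exists n : nat, x = - INR n.

(* Main.v *)
Require Import Defs.
From Stdlib Require Import Reals Lra Lia Psatz.
From Coquelicot Require Import Coquelicot.
Open Scope R_scope.

(** The series for E is differentiated term by term in alpha and then split
    according to the residue of the index k modulo q.  The k-th term has
    derivative - k x^k psi(z) / Gamma(z) at z = alpha k + beta.  At
    alpha = 1/q and k = q m + h one has z = a + m with a = h/q + beta, and
    Gamma(a + m) = (a)_m Gamma(a), so the residue class h contributes
    - x^h / Gamma(a) times the sum over m of (q m + h) c_m y^m, where y = x^q
    and c_m = psi(a + m) / (a)_m.  The power series with coefficients c_m is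
    psi(a) + Q(a, y), because Q omits only the term m = 0; the factor m turns
    it into y times its derivative, that is y P(a, y).  This gives the formula.

    The analytic content is the interchange of sum and derivative and the
    infinite radius of convergence of Q.  Both follow from one estimate
    ([rGamma_superexponential]): 1/Gamma(z) and psi(z)/Gamma(z) are
    O(exp(- L z)) as z tends to infinity, for every L.  The
    growth of Gamma is seen by restricting Euler's integral to [A, A + 1] for a
    large constant A.  The digamma function is controlled by
    |ln t| <= t + 1/t under the integral, which gives
    |Gamma'(z)| <= Gamma(z + 1) + Gamma(z - 1), and the functional equation
    turns this into |psi(z)| <= z + 1 for z >= 2.

    Term by term differentiation ([is_derive_Series]) asks for differentiability
    of finitely many terms at the point 1/q only: for small k the argument
    alpha k + beta may run through poles of Gamma when alpha varies, whereas
    for large k it stays above 2 as soon as alpha >= 1/(2 q). *)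

(** * Improper integrals over the positive half-line *)

Definition is_RInt_half_line (f : R -> R) (l : R) : Prop :=
  is_RInt_gen f (at_right 0) (Rbar_locally p_infty) l.

Definition continuous_half_line (f : R -> R) : Prop :=
  forall t, 0 < t -> continuous f t.

Lemma ex_RInt_half_line_sub (f : R -> R) (a b : R) :
  continuous_half_line f -> 0 < a -> 0 < b -> ex_RInt f a b.
Proof.
  intros Cf Ha Hb. apply (ex_RInt_continuous (V := R_CompleteNormedModule)). intros t Ht.
  apply Cf. apply Rlt_le_trans with (2 := proj1 Ht).
  now apply Rmin_glb_lt.
Qed.

Lemma at_right_lt (a : R) : 0 < a -> at_right 0 (fun t => 0 < t < a).
Proof.
  intros Ha. exists (mkposreal a Ha). intros t Ht Ht0.
  unfold ball in Ht; simpl in Ht; unfold AbsRing_ball, abs, minus, plus, opp in Ht.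
  simpl in Ht. split; [exact Ht0|].
  apply Rabs_def2 in Ht. lra.
Qed.

Lemma RInt_nonneg_widen (f : R -> R) (a' a b b' : R) :
  continuous_half_line f -> (forall t, 0 < t -> 0 <= f t) ->
  0 < a' <= a -> a <= b <= b' -> RInt f a b <= RInt f a' b'.
Proof.
  intros Cf Pf Ha Hb.
  assert (E1 := ex_RInt_half_line_sub f a' a Cf).
  assert (E2 := ex_RInt_half_line_sub f a b' Cf).
  assert (E3 := ex_RInt_half_line_sub f a b Cf).
  assert (E4 := ex_RInt_half_line_sub f b b' Cf).
  rewrite <- (RInt_Chasles f a' a b') by (try apply E1; try apply E2; lra).
  rewrite <- (RInt_Chasles f a b b') by (try apply E3; try apply E4; lra).
  unfold plus; simpl.
  assert (0 <= RInt f a' a).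
  { apply RInt_ge_0; [lra | apply E1; lra | intros; apply Pf; lra]. }
  assert (0 <= RInt f b b').
  { apply RInt_ge_0; [lra | apply E4; lra | intros; apply Pf; lra]. }
  lra.
Qed.

(** The integrals over [a, b] increase as the interval widens, so their
    supremum is their limit. *)
Lemma ex_RInt_half_line_bounded (f : R -> R) (M : R) :
  continuous_half_line f -> (forall t, 0 < t -> 0 <= f t) ->
  (forall a b, 0 < a <= b -> RInt f a b <= M) ->
  exists l, is_RInt_half_line f l.
Proof.
  intros Cf Pf HM.
  set (E := fun r => exists a b, 0 < a <= b /\ r = RInt f a b).
  destruct (completeness E) as [l [Hub Hlub]].
  - exists M. intros r (a & b & Hab & ->). now apply HM.
  - exists (RInt f 1 1), 1, 1. split; [lra | reflexivity].
  - exists l. intros U [eps HU].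
    assert (Hex : exists a b, 0 < a <= b /\ l - eps < RInt f a b).
    { apply Classical_Prop.NNPP. intros Hn.
      assert (l <= l - eps); [|destruct eps as [e he]; simpl in *; lra].
      apply Hlub. intros r (a & b & Hab & ->).
      apply Rnot_lt_le. intros Hl. apply Hn. now exists a, b. }
    destruct Hex as (a0 & b0 & Hab0 & Hl).
    apply (Filter_prod _ _ _ (fun t => 0 < t < a0) (fun t => b0 < t)).
    + apply at_right_lt; lra.
    + now exists b0.
    + intros a b Ha Hb. exists (RInt f a b). simpl. split.
      * apply (RInt_correct (V := R_CompleteNormedModule)).
        apply ex_RInt_half_line_sub; auto; lra.
      * apply HU. unfold ball; simpl; unfold AbsRing_ball, abs, minus, plus, opp; simpl.
        assert (RInt f a b <= l) by (apply Hub; exists a, b; split; auto; lra).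
        assert (RInt f a0 b0 <= RInt f a b)
          by (apply RInt_nonneg_widen; auto; lra).
        apply Rabs_def1; lra.
Qed.

(** Used both to bound proper integrals uniformly and to bound an improper
    integral from below by a piece of it. *)
Lemma RInt_le_half_line (f : R -> R) (l a b : R) :
  continuous_half_line f -> (forall t, 0 < t -> 0 <= f t) ->
  is_RInt_half_line f l -> 0 < a <= b -> RInt f a b <= l.
Proof.
  intros Cf Pf Hl Hab. apply Rnot_lt_le. intros Hlt.
  assert (Hd : 0 < RInt f a b - l) by lra.
  destruct (Hl (fun y => y < RInt f a b)) as [S T HS HT HST].
  { exists (mkposreal _ Hd). intros y Hy.
    unfold ball in Hy; simpl in Hy;
      unfold AbsRing_ball, abs, minus, plus, opp in Hy; simpl in Hy.
    apply Rabs_def2 in Hy. lra. }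
  destruct (filter_ex (F := at_right 0) _
              (filter_and _ _ HS (at_right_lt a (proj1 Hab)))) as [a' [Sa Ha']].
  assert (HT' : Rbar_locally p_infty (fun t => T t /\ b < t)).
  { apply filter_and; [exact HT | now exists b]. }
  destruct (filter_ex _ HT') as [b' [Tb Hb']].
  destruct (HST a' b' Sa Tb) as [y [Hy Hyl]]. simpl in Hy.
  assert (RInt f a' b' = y) by (apply is_RInt_unique; exact Hy).
  assert (RInt f a b <= RInt f a' b') by (apply RInt_nonneg_widen; auto; lra).
  lra.
Qed.

Lemma is_RInt_half_line_ext (f g : R -> R) (l : R) :
  (forall t, 0 < t -> f t = g t) -> is_RInt_half_line f l ->
  is_RInt_half_line g l.
Proof.
  intros H. apply is_RInt_gen_ext.
  apply (Filter_prod _ _ _ (fun t => 0 < t < 1) (fun t => 0 < t)).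
  - apply at_right_lt; lra.
  - now exists 0.
  - intros a b Ha Hb t Ht. simpl in Ht. apply H.
    apply Rlt_trans with (2 := proj1 Ht). apply Rmin_glb_lt; lra.
Qed.

Lemma is_RInt_half_line_plus (f g : R -> R) (lf lg : R) :
  is_RInt_half_line f lf -> is_RInt_half_line g lg ->
  is_RInt_half_line (fun t => f t + g t) (lf + lg).
Proof. exact (is_RInt_gen_plus (V := R_NormedModule) f g lf lg). Qed.

Lemma is_RInt_half_line_minus (f g : R -> R) (lf lg : R) :
  is_RInt_half_line f lf -> is_RInt_half_line g lg ->
  is_RInt_half_line (fun t => f t - g t) (lf - lg).
Proof. exact (is_RInt_gen_minus (V := R_NormedModule) f g lf lg). Qed.

Lemma is_RInt_half_line_scal (f : R -> R) (c l : R) :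
  is_RInt_half_line f l -> is_RInt_half_line (fun t => c * f t) (c * l).
Proof. exact (is_RInt_gen_scal (V := R_NormedModule) f c l). Qed.

Lemma is_RInt_half_line_unique (f : R -> R) (l1 l2 : R) :
  is_RInt_half_line f l1 -> is_RInt_half_line f l2 -> l1 = l2.
Proof.
  intros H1 H2.
  rewrite <- (is_RInt_gen_unique (V := R_CompleteNormedModule) f l1 H1).
  exact (is_RInt_gen_unique (V := R_CompleteNormedModule) f l2 H2).
Qed.

Lemma RInt_half_line_norm (f g : R -> R) (lf lg : R) :
  (forall t, 0 < t -> Rabs (f t) <= g t) ->
  is_RInt_half_line f lf -> is_RInt_half_line g lg -> Rabs lf <= lg.
Proof.
  intros H Hf Hg.
  refine (RInt_gen_norm (V := R_CompleteNormedModule) f g lf lg _ _ Hf Hg).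
  - apply (Filter_prod _ _ _ (fun t => 0 < t < 1) (fun t => 1 < t)).
    + apply at_right_lt; lra.
    + now exists 1.
    + intros; simpl; lra.
  - apply (Filter_prod _ _ _ (fun t => 0 < t < 1) (fun t => 1 < t)).
    + apply at_right_lt; lra.
    + now exists 1.
    + intros a b Ha Hb t Ht; simpl in Ht. apply H; lra.
Qed.

(** Reduces to the nonnegative case through f = (f + g) - g, where
    0 <= f + g <= 2 g. *)
Lemma ex_RInt_half_line_dominated (f g : R -> R) (lg : R) :
  continuous_half_line f -> continuous_half_line g ->
  (forall t, 0 < t -> Rabs (f t) <= g t) ->
  is_RInt_half_line g lg -> exists l, is_RInt_half_line f l.
Proof.
  intros Cf Cg H Hg.
  assert (Pg : forall t, 0 < t -> 0 <= g t).
  { intros t Ht. apply Rle_trans with (2 := H t Ht). apply Rabs_pos. }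
  destruct (ex_RInt_half_line_bounded (fun t => f t + g t) (2 * lg))
    as [l Hl].
  - intros t Ht. apply (continuous_plus f g); auto.
  - intros t Ht. specialize (H t Ht). apply Rabs_le_between in H. lra.
  - intros a b Hab.
    apply Rle_trans with (RInt (fun t => 2 * g t) a b).
    + apply RInt_le; try lra.
      * apply ex_RInt_half_line_sub; try lra.
        intros t Ht. apply (continuous_plus f g); auto.
      * apply ex_RInt_half_line_sub; try lra.
        intros t Ht. apply (continuous_scal_r 2 g); auto.
      * intros t Ht. assert (Ht' : 0 < t) by lra. specialize (H t Ht').
        apply Rabs_le_between in H. lra.
    + rewrite (RInt_scal (V := R_CompleteNormedModule))
        by (apply ex_RInt_half_line_sub; auto; lra).
      apply Rmult_le_compat_l; [lra|].
      now apply RInt_le_half_line.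
  - exists (l - lg).
    apply is_RInt_half_line_ext with (fun t => f t + g t - g t).
    + intros t _. ring.
    + now apply is_RInt_half_line_minus with (1 := Hl).
Qed.

(** * Euler's integral of the second kind *)

(** The exponent z - 1 matches the integrand of [euler_integral] literally, so
    that the two are convertible. *)
Definition euler_kernel (z t : R) : R := Rpower t (z - 1) * exp (- t).

Lemma euler_kernel_pos (z t : R) : 0 < euler_kernel z t.
Proof. apply Rmult_lt_0_compat; apply exp_pos. Qed.

Lemma continuous_euler_kernel (z : R) : continuous_half_line (euler_kernel z).
Proof.
  intros t Ht. apply (ex_derive_continuous (euler_kernel z)).
  unfold euler_kernel, Rpower. now auto_derive.
Qed.

Lemma continuous_ln_euler_kernel (z : R) :
  continuous_half_line (fun t => ln t * euler_kernel z t).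
Proof.
  intros t Ht. apply (ex_derive_continuous (fun t => ln t * euler_kernel z t)).
  unfold euler_kernel, Rpower. now auto_derive.
Qed.

Lemma exp_le (u v : R) : u <= v -> exp u <= exp v.
Proof.
  intros [H | ->]; [now apply Rlt_le, exp_increasing | apply Rle_refl].
Qed.

Lemma ln_le_sub_one (u : R) : 0 < u -> ln u <= u - 1.
Proof.
  intros Hu. assert (H := exp_ineq1_le (ln u)). rewrite exp_ln in H; lra.
Qed.

(** The maximum of t^c exp(-t) is attained at t = c; in logarithms this is
    ln (t / c) <= t / c - 1. *)
Lemma Rpower_le_exp (c t : R) :
  0 < c -> 0 < t -> Rpower t c <= Rpower c c * exp t.
Proof.
  intros Hc Ht. unfold Rpower. rewrite <- exp_plus. apply exp_le.
  assert (Htc : 0 < t / c) by now apply Rdiv_lt_0_compat.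
  assert (H := ln_le_sub_one (t / c) Htc).
  rewrite ln_div in H by assumption.
  assert (c * (ln t - ln c) <= c * (t / c - 1)) by (apply Rmult_le_compat_l; lra).
  replace (c * (t / c - 1)) with (t - c) in H0 by (field; lra). lra.
Qed.

(** The integrand is dominated by C t^(z-1) / (1 + t^z)^2, which has the bounded
    primitive - C / (z (1 + t^z)): near 0 the dominating function behaves like
    t^(z-1), at infinity like t^(-z-1). *)
Lemma ex_euler_integral (z : R) :
  0 < z -> exists l, is_RInt_half_line (euler_kernel z) l.
Proof.
  intros Hz.
  set (K := Rpower (2 * z) (2 * z)).
  assert (HK : 0 < K) by apply exp_pos.
  (* K comes from t^(2z) <= K exp t, and (1 + t^z)^2 <= 2 (1 + t^(2z)) *)
  set (C := 2 * (1 + K)).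
  set (h := fun t => - (C / (z * (1 + Rpower t z)))).
  set (dh := fun t => C * Rpower t (z - 1) / (1 + Rpower t z) ^ 2).
  assert (Hh : forall t, 0 < t -> is_derive h t (dh t)).
  { intros t Ht. unfold h, dh, Rpower. auto_derive.
    - split; [exact Ht|]. split; [|exact I].
      assert (0 < exp (z * ln t)) by apply exp_pos. nra.
    - replace ((z - 1) * ln t) with (z * ln t + - ln t) by ring.
      rewrite exp_plus, exp_Ropp, (exp_ln t Ht).
      assert (0 < exp (z * ln t)) by apply exp_pos.
      field. repeat split; lra. }
  assert (Cdh : continuous_half_line dh).
  { intros t Ht. apply (ex_derive_continuous dh). unfold dh, Rpower.
    assert (0 < exp (z * ln t)) by apply exp_pos.
    auto_derive. repeat split; try assumption; nra. }
  apply ex_RInt_half_line_bounded with (C / z).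
  - apply continuous_euler_kernel.
  - intros t _. apply Rlt_le, euler_kernel_pos.
  - intros a b Hab.
    assert (Hint : is_RInt dh a b (minus (h b) (h a))).
    { apply (is_RInt_derive h dh); intros t Ht;
        rewrite Rmin_left, Rmax_right in Ht by lra.
      - apply Hh; lra.
      - apply Cdh; lra. }
    apply Rle_trans with (RInt dh a b).
    + apply RInt_le; try lra.
      * apply ex_RInt_half_line_sub; try lra. apply continuous_euler_kernel.
      * eexists; exact Hint.
      * intros t Ht. unfold dh, euler_kernel, Rdiv.
        rewrite (Rmult_comm C), Rmult_assoc.
        apply Rmult_le_compat_l; [apply Rlt_le, exp_pos|].
        set (p := Rpower t z). assert (Hp : 0 < p) by apply exp_pos.
        apply (Rmult_le_reg_r ((1 + p) ^ 2)); [nra|].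
        rewrite Rmult_assoc, Rinv_l by nra.
        assert (H1 : p * p <= K * exp t).
        { unfold p. rewrite <- Rpower_plus. replace (z + z) with (2 * z) by ring.
          apply Rpower_le_exp; lra. }
        assert (H2 : 1 + t <= exp t) by apply exp_ineq1_le.
        assert (H3 : (1 + p) ^ 2 <= C * exp t).
        { assert (0 <= (1 - p) ^ 2) by apply pow2_ge_0. unfold C. lra. }
        apply Rle_trans with (exp (- t) * (C * exp t)).
        { apply Rmult_le_compat_l; [apply Rlt_le, exp_pos | exact H3]. }
        rewrite exp_Ropp. right. field. apply Rgt_not_eq, exp_pos.
    + rewrite (is_RInt_unique _ _ _ _ Hint).
      unfold minus, plus, opp, h; simpl.
      assert (0 < Rpower a z) by apply exp_pos.
      assert (0 < Rpower b z) by apply exp_pos.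
      assert (HC : 0 < C) by (unfold C; lra).
      assert (0 < C / (z * (1 + Rpower b z))) by (apply Rdiv_lt_0_compat; nra).
      assert (C / (z * (1 + Rpower a z)) <= C / z).
      { apply Rmult_le_compat_l; [lra|]. apply Rinv_le_contravar; nra. }
      lra.
Qed.

Lemma is_euler_integral (z : R) :
  0 < z -> is_RInt_half_line (euler_kernel z) (euler_integral z).
Proof.
  intros Hz.
  exact (RInt_gen_correct (V := R_CompleteNormedModule) _
           (ex_euler_integral z Hz)).
Qed.

(** From exp v >= 1 + v and exp (-v) >= 1 - v one gets
    0 <= exp v - 1 - v <= v (exp v - 1). *)
Lemma exp_remainder (v : R) : Rabs (exp v - 1 - v) <= v ^ 2 * exp (Rabs v).
Proof.
  assert (H1 := exp_ineq1_le v). assert (H2 := exp_ineq1_le (- v)).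
  assert (Hp := exp_pos v).
  assert (H3 : exp v * exp (- v) = 1)
    by (rewrite <- exp_plus, Rplus_opp_r; apply exp_0).
  assert (H4 : exp v - 1 <= v * exp v) by nra.
  rewrite Rabs_pos_eq by lra.
  assert (H5 : exp v - 1 - v <= v * (exp v - 1)) by lra.
  apply Rle_trans with (1 := H5).
  destruct (Rle_lt_dec 0 v) as [Hv | Hv].
  - rewrite Rabs_pos_eq by exact Hv. nra.
  - assert (1 <= exp (Rabs v)).
    { assert (H6 := exp_ineq1_le (Rabs v)). assert (0 <= Rabs v) by apply Rabs_pos.
      lra. }
    assert (v * (exp v - 1) <= v ^ 2) by nra. nra.
Qed.

Lemma exp_abs_le (v : R) : exp (Rabs v) <= exp v + exp (- v).
Proof.
  assert (0 < exp v) by apply exp_pos. assert (0 < exp (- v)) by apply exp_pos.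
  unfold Rabs. destruct (Rcase_abs v); lra.
Qed.

Lemma euler_kernel_shift (z h t : R) :
  euler_kernel (z + h) t = exp (h * ln t) * euler_kernel z t.
Proof.
  unfold euler_kernel, Rpower.
  replace ((z + h - 1) * ln t) with (h * ln t + (z - 1) * ln t) by ring.
  rewrite exp_plus. ring.
Qed.

Lemma abs_ln_le (d t : R) : 0 < d ->
  Rabs (ln t) <= (exp (d * ln t) + exp (- d * ln t)) / d.
Proof.
  intros Hd. apply (Rmult_le_reg_l d); [exact Hd|].
  replace (d * ((exp (d * ln t) + exp (- d * ln t)) / d))
    with (exp (d * ln t) + exp (- d * ln t)) by (field; lra).
  assert (H := exp_abs_le (d * ln t)).
  replace (- (d * ln t)) with (- d * ln t) in H by ring.
  rewrite Rabs_mult, (Rabs_pos_eq d) in H by lra.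
  assert (H1 := exp_ineq1_le (d * Rabs (ln t))). lra.
Qed.

(** Multiplying the kernel by t^d or t^-d only shifts z, so a logarithm under
    the integral is controlled by two neighbouring Euler integrals. *)
Lemma abs_ln_euler_kernel_le (z d t : R) : 0 < d ->
  Rabs (ln t * euler_kernel z t)
    <= / d * (euler_kernel (z + d) t + euler_kernel (z - d) t).
Proof.
  intros Hd. unfold Rminus. rewrite !euler_kernel_shift.
  assert (Hp := euler_kernel_pos z t).
  rewrite Rabs_mult, (Rabs_pos_eq (euler_kernel z t)) by lra.
  assert (H := abs_ln_le d t Hd).
  apply Rle_trans with (1 := Rmult_le_compat_r _ _ _ (Rlt_le _ _ Hp) H).
  right. field. lra.
Qed.

Lemma is_RInt_half_line_kernel_pair (z d c : R) : 0 < z - d -> 0 < d ->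
  is_RInt_half_line
    (fun t => c * (euler_kernel (z + d) t + euler_kernel (z - d) t))
    (c * (euler_integral (z + d) + euler_integral (z - d))).
Proof.
  intros H1 H2.
  apply (is_RInt_half_line_scal
           (fun t => euler_kernel (z + d) t + euler_kernel (z - d) t)).
  apply is_RInt_half_line_plus; apply is_euler_integral; lra.
Qed.

Lemma continuous_kernel_pair (z d c : R) : continuous_half_line
    (fun t => c * (euler_kernel (z + d) t + euler_kernel (z - d) t)).
Proof.
  intros t Ht.
  apply (continuous_scal_r c
           (fun t => euler_kernel (z + d) t + euler_kernel (z - d) t)).
  apply (continuous_plus (euler_kernel (z + d)) (euler_kernel (z - d)));
    now apply continuous_euler_kernel.
Qed.

Lemma ex_ln_euler_integral (z : R) : 0 < z ->
  exists l, is_RInt_half_line (fun t => ln t * euler_kernel z t) l.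
Proof.
  intros Hz.
  apply ex_RInt_half_line_dominated with
    (g := fun t => / (z / 2) *
       (euler_kernel (z + z / 2) t + euler_kernel (z - z / 2) t))
    (lg := / (z / 2) * (euler_integral (z + z / 2) + euler_integral (z - z / 2))).
  - apply continuous_ln_euler_kernel.
  - apply continuous_kernel_pair.
  - intros t _. apply abs_ln_euler_kernel_le; lra.
  - apply is_RInt_half_line_kernel_pair; lra.
Qed.

(** Second-order remainder of the kernel in z, dominated uniformly in h by
    an integrable function: with u = ln t the remainder is at most
    (h u)^2 exp (d |u|), and u^2 is absorbed by another factor exp (d |u|). *)
Lemma euler_kernel_remainder (z d h t : R) : 0 < d -> Rabs h <= d ->
  Rabs (euler_kernel (z + h) t - euler_kernel z t - h * (ln t * euler_kernel z t))
    <= 4 * h ^ 2 / d ^ 2 *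
       (euler_kernel (z + 2 * d) t + euler_kernel (z - 2 * d) t).
Proof.
  intros Hd Hh.
  assert (Hp := euler_kernel_pos z t). replace (z - 2 * d) with (z + - (2 * d)) by ring.
  rewrite !euler_kernel_shift.
  replace (exp (h * ln t) * euler_kernel z t - euler_kernel z t -
           h * (ln t * euler_kernel z t))
    with ((exp (h * ln t) - 1 - h * ln t) * euler_kernel z t) by ring.
  rewrite Rabs_mult, (Rabs_pos_eq (euler_kernel z t)) by lra.
  rewrite <- Rmult_plus_distr_r, <- Rmult_assoc.
  apply Rmult_le_compat_r; [lra|].
  set (u := ln t).
  apply Rle_trans with (1 := exp_remainder (h * u)).
  set (e := exp (d * Rabs u)).
  assert (He : 0 < e) by apply exp_pos.
  assert (H1 : exp (Rabs (h * u)) <= e).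
  { apply exp_le. rewrite Rabs_mult. apply Rmult_le_compat_r; [apply Rabs_pos | exact Hh]. }
  (* u^2 is bounded through v <= exp v at v = d |u| / 2 *)
  assert (H2 : d ^ 2 * u ^ 2 / 4 <= e).
  { unfold e. replace (d * Rabs u) with (d * Rabs u / 2 + d * Rabs u / 2) by field.
    rewrite exp_plus.
    assert (H := exp_ineq1_le (d * Rabs u / 2)).
    assert (0 <= d * Rabs u / 2) by (assert (0 <= Rabs u) by apply Rabs_pos; nra).
    replace (d ^ 2 * u ^ 2 / 4) with ((d * Rabs u / 2) * (d * Rabs u / 2))
      by (rewrite <- (pow2_abs u); field).
    apply Rmult_le_compat; lra. }
  assert (H3 : e * e <= exp (2 * d * u) + exp (- (2 * d) * u)).
  { unfold e. rewrite <- exp_plus.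
    replace (d * Rabs u + d * Rabs u) with (Rabs (2 * d * u)).
    - replace (- (2 * d) * u) with (- (2 * d * u)) by ring. apply exp_abs_le.
    - rewrite Rabs_mult, (Rabs_pos_eq (2 * d)) by lra. ring. }
  assert (H4 : u ^ 2 <= 4 / d ^ 2 * e).
  { apply (Rmult_le_reg_l (d ^ 2 / 4)); [nra|].
    replace (d ^ 2 / 4 * (4 / d ^ 2 * e)) with e by (field; lra). lra. }
  apply Rle_trans with (h ^ 2 * (4 / d ^ 2 * e) * e).
  - replace ((h * u) ^ 2) with (h ^ 2 * u ^ 2) by ring.
    apply Rmult_le_compat; try (apply Rlt_le, exp_pos); try exact H1.
    + apply Rmult_le_pos; apply pow2_ge_0.
    + apply Rmult_le_compat_l; [apply pow2_ge_0 | exact H4].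
  - replace (h ^ 2 * (4 / d ^ 2 * e) * e) with (4 * h ^ 2 / d ^ 2 * (e * e))
      by (field; lra).
    apply Rmult_le_compat_l; [|exact H3].
    apply Rmult_le_pos; [assert (0 <= h ^ 2) by apply pow2_ge_0; lra|].
    apply Rlt_le, Rinv_0_lt_compat. nra.
Qed.

Lemma is_derive_quadratic (f : R -> R) (z l C d : R) : 0 < d ->
  (forall h, Rabs h <= d -> Rabs (f (z + h) - f z - h * l) <= C * h ^ 2) ->
  is_derive f z l.
Proof.
  intros Hd H. apply is_derive_Reals. intros eps Heps.
  set (C' := Rabs C + 1).
  assert (HC' : 0 < C') by (unfold C'; assert (0 <= Rabs C) by apply Rabs_pos; lra).
  assert (Hm : 0 < Rmin d (eps / C')).
  { apply Rmin_glb_lt; [exact Hd | now apply Rdiv_lt_0_compat]. }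
  exists (mkposreal _ Hm). intros h Hh0 Hh. simpl in Hh.
  assert (Hhd : Rabs h <= d) by (apply Rlt_le, Rlt_le_trans with (1 := Hh), Rmin_l).
  assert (Hhe : Rabs h < eps / C') by (apply Rlt_le_trans with (1 := Hh), Rmin_r).
  specialize (H h Hhd).
  assert (Ha : 0 < Rabs h) by now apply Rabs_pos_lt.
  replace ((f (z + h) - f z) / h - l) with ((f (z + h) - f z - h * l) / h)
    by now field.
  unfold Rdiv. rewrite Rabs_mult, Rabs_inv.
  apply (Rmult_lt_reg_r (Rabs h)); [exact Ha|].
  rewrite Rmult_assoc, Rinv_l, Rmult_1_r by lra.
  apply Rle_lt_trans with (1 := H).
  apply Rle_lt_trans with (C' * Rabs h * Rabs h).
  - rewrite <- (pow2_abs h). assert (C <= Rabs C) by apply Rle_abs. unfold C'. nra.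
  - apply Rmult_lt_compat_r; [exact Ha|].
    apply (Rmult_lt_reg_r (/ C')); [now apply Rinv_0_lt_compat|].
    replace (C' * Rabs h * / C') with (Rabs h) by (field; lra). exact Hhe.
Qed.

(** Differentiation under the integral sign: the remainder of the integral
    is O(h^2) because that of the integrand is. *)
Lemma is_derive_euler_integral (z l : R) : 0 < z ->
  is_RInt_half_line (fun t => ln t * euler_kernel z t) l ->
  is_derive euler_integral z l.
Proof.
  intros Hz Hl.
  (* d = z / 4 keeps z - 2 d > 0, so that both dominating integrals converge *)
  set (d := z / 4).
  apply is_derive_quadratic with
    (C := 4 / d ^ 2 * (euler_integral (z + 2 * d) + euler_integral (z - 2 * d)))
    (d := d); [unfold d; lra|].
  intros h Hh. assert (Hh' := Hh). apply Rabs_le_between in Hh'.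
  replace (4 / d ^ 2 * (euler_integral (z + 2 * d) + euler_integral (z - 2 * d)) * h ^ 2)
    with (4 * h ^ 2 / d ^ 2 *
          (euler_integral (z + 2 * d) + euler_integral (z - 2 * d)))
    by (field; unfold d; lra).
  apply RInt_half_line_norm with
    (f := fun t => euler_kernel (z + h) t - euler_kernel z t
                   - h * (ln t * euler_kernel z t))
    (g := fun t => 4 * h ^ 2 / d ^ 2 *
       (euler_kernel (z + 2 * d) t + euler_kernel (z - 2 * d) t)).
  - intros t _. apply euler_kernel_remainder; [unfold d; lra | exact Hh].
  - apply (is_RInt_half_line_minus
             (fun t => euler_kernel (z + h) t - euler_kernel z t)
             (fun t => h * (ln t * euler_kernel z t))).
    + apply is_RInt_half_line_minus; apply is_euler_integral;
        unfold d in *; lra.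
    + now apply is_RInt_half_line_scal.
  - apply is_RInt_half_line_kernel_pair; unfold d; lra.
Qed.

Lemma ex_derive_euler_integral (z : R) : 0 < z -> ex_derive euler_integral z.
Proof.
  intros Hz. destruct (ex_ln_euler_integral z Hz) as [l Hl].
  exists l. now apply is_derive_euler_integral.
Qed.

(** This is |ln t| <= t + 1/t under the integral sign. *)
Lemma abs_Derive_euler_integral_le (z : R) : 1 < z ->
  Rabs (Derive euler_integral z)
    <= euler_integral (z + 1) + euler_integral (z - 1).
Proof.
  intros Hz. assert (Hz0 : 0 < z) by lra.
  destruct (ex_ln_euler_integral z Hz0) as [l Hl].
  rewrite (is_derive_unique _ _ _ (is_derive_euler_integral z l Hz0 Hl)).
  rewrite <- (Rmult_1_l (_ + _)), <- Rinv_1 at 1.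
  apply RInt_half_line_norm with (2 := Hl)
    (3 := is_RInt_half_line_kernel_pair z 1 (/ 1) ltac:(lra) Rlt_0_1).
  intros t _. apply abs_ln_euler_kernel_le; lra.
Qed.

(** Integration by parts: the primitive - t^z exp (-t) vanishes at both ends. *)
Lemma euler_integral_succ (z : R) : 0 < z ->
  euler_integral (z + 1) = z * euler_integral z.
Proof.
  intros Hz.
  set (F := fun t => - euler_kernel (z + 1) t).
  set (dF := fun t => euler_kernel (z + 1) t - z * euler_kernel z t).
  assert (HF : forall t, 0 < t -> is_derive F t (dF t)).
  { intros t Ht. unfold F, dF, euler_kernel, Rpower. auto_derive; [exact Ht|].
    replace ((z + 1 - 1) * ln t) with (z * ln t) by ring.
    replace ((z - 1) * ln t) with (z * ln t + - ln t) by ring.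
    rewrite exp_plus, (exp_Ropp (ln t)), (exp_ln t Ht). field. lra. }
  assert (CF : continuous_half_line dF).
  { intros t Ht. apply (ex_derive_continuous dF). unfold dF, euler_kernel, Rpower.
    now auto_derive. }
  assert (Hint : is_RInt_half_line dF (0 - 0)).
  { apply is_RInt_half_line_ext with (Derive F).
    { intros t Ht. now apply is_derive_unique, HF. }
    assert (Hpos : filter_prod (at_right 0) (Rbar_locally p_infty)
      (fun ab => forall t, Rmin (fst ab) (snd ab) <= t <= Rmax (fst ab) (snd ab) ->
         0 < t)).
    { apply (Filter_prod _ _ _ (fun t => 0 < t < 1) (fun t => 0 < t)).
      - apply at_right_lt; lra.
      - now exists 0.
      - intros a b Ha Hb t Ht. simpl in Ht.
        apply Rlt_le_trans with (2 := proj1 Ht). apply Rmin_glb_lt; lra. }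
    refine (is_RInt_gen_Derive F 0 0 _ _ _ _).
    - revert Hpos. apply filter_imp. intros ab Hab t Ht.
      eexists; apply HF; eauto.
    - revert Hpos. apply filter_imp. intros ab Hab t Ht.
      apply continuous_ext_loc with dF.
      + exists (mkposreal t (Hab t Ht)). intros y Hy. symmetry.
        apply is_derive_unique, HF.
        unfold ball in Hy; simpl in Hy;
          unfold AbsRing_ball, abs, minus, plus, opp in Hy; simpl in Hy.
        apply Rabs_def2 in Hy. lra.
      + apply CF; eauto.
    (* near 0 the kernel at z + 1 is at most t^z *)
    - intros U [eps HU].
      apply filter_imp with (2 := at_right_lt (Rpower eps (/ z)) (exp_pos _)).
      intros t Ht. apply HU.
      unfold ball; simpl; unfold AbsRing_ball, abs, minus, plus, opp; simpl.
      unfold F. rewrite Ropp_0, Rplus_0_r, Rabs_Ropp,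
        Rabs_pos_eq by apply Rlt_le, euler_kernel_pos.
      unfold euler_kernel. replace (z + 1 - 1) with z by ring.
      assert (H1 : exp (- t) <= 1).
      { rewrite <- exp_0. apply exp_le. lra. }
      assert (H2 : Rpower t z < eps).
      { rewrite <- (Rpower_1 eps) by apply cond_pos.
        rewrite <- (Rinv_l z) by lra. rewrite <- Rpower_mult.
        apply Rlt_Rpower_l; lra. }
      assert (0 < Rpower t z) by apply exp_pos.
      assert (0 < exp (- t)) by apply exp_pos. nra.
    (* near infinity it is at most K / t, because t^(z + 1) <= K exp t *)
    - intros U [eps HU]. set (K := Rpower (z + 1) (z + 1)).
      assert (HK : 0 < K) by apply exp_pos.
      exists (K / eps). intros t Ht. apply HU.
      assert (Heps := cond_pos eps).
      assert (Ht0 : 0 < t) by (assert (0 < K / eps) by (now apply Rdiv_lt_0_compat); lra).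
      unfold ball; simpl; unfold AbsRing_ball, abs, minus, plus, opp; simpl.
      unfold F. rewrite Ropp_0, Rplus_0_r, Rabs_Ropp,
        Rabs_pos_eq by apply Rlt_le, euler_kernel_pos.
      unfold euler_kernel. replace (z + 1 - 1) with z by ring.
      assert (H := Rpower_le_exp (z + 1) t ltac:(lra) Ht0). fold K in H.
      rewrite Rpower_plus, Rpower_1 in H by exact Ht0.
      apply (Rmult_lt_reg_r t); [exact Ht0|].
      apply Rle_lt_trans with K.
      + rewrite exp_Ropp. assert (He := exp_pos t).
        apply (Rmult_le_reg_r (exp t)); [exact He|].
        replace (Rpower t z * / exp t * t * exp t) with (Rpower t z * t)
          by (field; lra). exact H.
      + apply (Rmult_lt_compat_r eps) in Ht; [|exact Heps].
        replace (K / eps * eps) with K in Ht by (field; lra). lra. }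
  assert (Hint2 : is_RInt_half_line dF (euler_integral (z + 1) - z * euler_integral z)).
  { apply (is_RInt_half_line_minus _ (fun t => z * euler_kernel z t)).
    - apply is_euler_integral; lra.
    - apply is_RInt_half_line_scal, is_euler_integral; lra. }
  assert (H := is_RInt_half_line_unique _ _ _ Hint Hint2). lra.
Qed.

(** Keeps only the integral over [A, A + 1].  As A is arbitrary, Gamma grows
    faster than every exponential. *)
Lemma euler_integral_lower (z A : R) : 1 <= z -> 0 < A ->
  Rpower A (z - 1) * exp (- (A + 1)) <= euler_integral z.
Proof.
  intros Hz HA.
  apply Rle_trans with (RInt (euler_kernel z) A (A + 1)).
  - replace (Rpower A (z - 1) * exp (- (A + 1)))
      with (RInt (fun _ => Rpower A (z - 1) * exp (- (A + 1))) A (A + 1)).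
    + apply RInt_le; [lra | apply ex_RInt_const | |].
      * apply ex_RInt_half_line_sub; try lra. apply continuous_euler_kernel.
      * intros t Ht. apply Rmult_le_compat; try (apply Rlt_le, exp_pos).
        -- apply Rle_Rpower_l; lra.
        -- apply exp_le; lra.
    + rewrite RInt_const. unfold scal; simpl; unfold mult; simpl. ring.
  - apply RInt_le_half_line; try lra.
    + apply continuous_euler_kernel.
    + intros t _. apply Rlt_le, euler_kernel_pos.
    + apply is_euler_integral; lra.
Qed.

Lemma euler_integral_pos (z : R) : 0 < z -> 0 < euler_integral z.
Proof.
  intros Hz.
  assert (H : 0 < euler_integral (z + 1)).
  { apply Rlt_le_trans with (2 := euler_integral_lower (z + 1) 1 ltac:(lra) Rlt_0_1).
    apply Rmult_lt_0_compat; apply exp_pos. }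
  rewrite euler_integral_succ in H by exact Hz. nra.
Qed.

(** * Gamma and digamma on the real line *)

Lemma pochhammer_add (a : R) (m n : nat) :
  pochhammer a (m + n) = pochhammer a m * pochhammer (a + INR m) n.
Proof.
  induction n as [|n IH]; simpl.
  - rewrite Nat.add_0_r. ring.
  - rewrite Nat.add_succ_r. simpl. rewrite IH, plus_INR. ring.
Qed.

Lemma pochhammer_pos (a : R) (n : nat) : 0 < a -> 0 < pochhammer a n.
Proof.
  intros Ha. induction n as [|n IH]; simpl; [lra|].
  assert (0 <= INR n) by apply pos_INR.
  apply Rmult_lt_0_compat; lra.
Qed.

Lemma pochhammer_neq_0 (a : R) (n : nat) :
  ~ nonpositive_integer a -> pochhammer a n <> 0.
Proof.
  intros Ha. induction n as [|n IH]; simpl; [lra|].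
  apply Rmult_integral_contrapositive_currified; [exact IH|].
  intros H. apply Ha. exists n. lra.
Qed.

Lemma ex_derive_pochhammer (n : nat) (a : R) :
  ex_derive (fun y => pochhammer y n) a.
Proof.
  induction n as [|n IH]; simpl.
  - apply ex_derive_const.
  - apply (ex_derive_mult (fun y => pochhammer y n) (fun y => y + INR n));
      [exact IH | auto_derive; exact I].
Qed.

Lemma euler_integral_add (z : R) (n : nat) : 0 < z ->
  euler_integral (z + INR n) = pochhammer z n * euler_integral z.
Proof.
  intros Hz. induction n as [|n IH].
  - simpl. rewrite Rplus_0_r. ring.
  - rewrite S_INR, <- Rplus_assoc.
    assert (0 <= INR n) by apply pos_INR.
    rewrite euler_integral_succ by lra. rewrite IH. simpl. ring.
Qed.

Lemma gamma_shift_spec (x : R) : 0 < x + INR (gamma_shift x).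
Proof.
  unfold gamma_shift. destruct (archimed (- x)) as [H _].
  rewrite INR_IZR_INZ, ZifyInst.of_nat_to_nat_eq.
  assert (IZR (up (- x)) <= IZR (Z.max 0 (up (- x)))) by (apply IZR_le; lia).
  lra.
Qed.

Lemma gamma_shift_le (x : R) (n : nat) :
  0 < x + INR n -> (gamma_shift x <= n)%nat.
Proof.
  intros Hn. unfold gamma_shift. destruct (archimed (- x)) as [_ H].
  rewrite INR_IZR_INZ in Hn.
  assert (Hup : IZR (up (- x)) < IZR (Z.of_nat n + 1)) by (rewrite plus_IZR; lra).
  apply lt_IZR in Hup. lia.
Qed.

(** Any shift into the positive half-line computes Gamma, not only the least
    one, because the factors of a further shift cancel.  Inversion is
    multiplicative also at 0, so the poles need no exception. *)
Lemma Gamma_shift (x : R) (n : nat) : 0 < x + INR n ->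
  Gamma x = euler_integral (x + INR n) / pochhammer x n.
Proof.
  intros Hn. assert (Hs := gamma_shift_spec x).
  assert (Hle := gamma_shift_le x n Hn). unfold Gamma.
  set (s := gamma_shift x) in *.
  replace n with (s + (n - s))%nat by lia. set (k := (n - s)%nat).
  rewrite plus_INR, <- Rplus_assoc, (euler_integral_add (x + INR s) k Hs).
  rewrite pochhammer_add. assert (Hp := pochhammer_pos (x + INR s) k Hs).
  unfold Rdiv. rewrite Rinv_mult.
  set (i := / pochhammer x s). field. lra.
Qed.

Lemma rGamma_inv (x : R) : rGamma x = / Gamma x.
Proof.
  unfold rGamma, Gamma, Rdiv. rewrite Rinv_mult, Rinv_inv. ring.
Qed.

Lemma Gamma_euler_integral (z : R) : 0 < z -> Gamma z = euler_integral z.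
Proof.
  intros Hz. rewrite (Gamma_shift z 0) by (simpl; lra).
  simpl. rewrite Rplus_0_r. field.
Qed.

Lemma Gamma_add (a : R) (m : nat) : ~ nonpositive_integer a ->
  Gamma (a + INR m) = pochhammer a m * Gamma a.
Proof.
  intros Ha. set (n := gamma_shift a).
  assert (Hn : 0 < a + INR n) by apply gamma_shift_spec.
  assert (0 <= INR m) by apply pos_INR.
  rewrite (Gamma_shift (a + INR m) n) by lra.
  rewrite (Gamma_shift a n) by exact Hn.
  replace (a + INR m + INR n) with (a + INR n + INR m) by ring.
  rewrite (euler_integral_add (a + INR n) m Hn).
  assert (H1 := pochhammer_add a m n). assert (H2 := pochhammer_add a n m).
  rewrite Nat.add_comm, H1 in H2.
  assert (Hnz := pochhammer_neq_0 a (m + n) Ha). rewrite H1 in Hnz.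
  assert (Hnz' := pochhammer_neq_0 a n Ha).
  assert (pochhammer (a + INR m) n <> 0) by (intros E; rewrite E in Hnz; lra).
  unfold Rdiv. apply (Rmult_eq_reg_r (pochhammer a n * pochhammer (a + INR m) n)).
  - transitivity ((pochhammer a n * pochhammer (a + INR n) m)
                  * euler_integral (a + INR n)); [field; lra|].
    rewrite <- H2. field; lra.
  - now apply Rmult_integral_contrapositive_currified.
Qed.

Lemma nonpole_add (a : R) (m : nat) :
  ~ nonpositive_integer a -> ~ nonpositive_integer (a + INR m).
Proof.
  intros Ha [n Hn]. apply Ha. exists (n + m)%nat. rewrite plus_INR. lra.
Qed.

Lemma Gamma_neq_0 (a : R) : ~ nonpositive_integer a -> Gamma a <> 0.
Proof.
  intros Ha. unfold Gamma.
  assert (H := euler_integral_pos _ (gamma_shift_spec a)).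
  apply Rmult_integral_contrapositive_currified; [lra|].
  now apply Rinv_neq_0_compat, pochhammer_neq_0.
Qed.

Lemma locally_gt (c x : R) : c < x -> locally x (fun y => c < y).
Proof. apply (open_gt c). Qed.

(** With the shift frozen at its value at a, [Gamma_shift] is a differentiable
    formula for Gamma on a neighbourhood of a. *)
Lemma ex_derive_Gamma (a : R) : ~ nonpositive_integer a -> ex_derive Gamma a.
Proof.
  intros Ha. set (n := gamma_shift a).
  assert (Hn : 0 < a + INR n) by apply gamma_shift_spec.
  apply ex_derive_ext_loc with
    (fun y => euler_integral (y + INR n) / pochhammer y n).
  - assert (Hn' : - INR n < a) by lra.
    apply filter_imp with (2 := locally_gt _ _ Hn').
    intros y Hy. symmetry. apply Gamma_shift. lra.
  - apply (ex_derive_div (fun y => euler_integral (y + INR n))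
             (fun y => pochhammer y n)).
    + apply (ex_derive_comp euler_integral (fun y => y + INR n)).
      * now apply ex_derive_euler_integral.
      * auto_derive; exact I.
    + apply ex_derive_pochhammer.
    + now apply pochhammer_neq_0.
Qed.

Lemma is_derive_rGamma (a : R) : ~ nonpositive_integer a ->
  is_derive rGamma a (- digamma a / Gamma a).
Proof.
  intros Ha. assert (Hz := Gamma_neq_0 a Ha).
  apply is_derive_ext with (fun y => / Gamma y).
  - intros y. symmetry. apply rGamma_inv.
  - replace (- digamma a / Gamma a) with (- Derive Gamma a / Gamma a ^ 2)
      by (unfold digamma; field; exact Hz).
    apply is_derive_inv; [|exact Hz].
    now apply Derive_correct, ex_derive_Gamma.
Qed.

Lemma nonpole_pos (z : R) : 0 < z -> ~ nonpositive_integer z.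
Proof.
  intros Hz [n Hn]. assert (0 <= INR n) by apply pos_INR. lra.
Qed.

(** The bound z + 1 obtained from the Euler integrals is relaxed to exp z,
    which combines with other exponentials. *)
Lemma abs_digamma_le (z : R) : 2 <= z -> Rabs (digamma z) <= exp z.
Proof.
  intros Hz. unfold digamma.
  rewrite (Derive_ext_loc Gamma euler_integral).
  2: { assert (Hz0 : 0 < z) by lra.
       apply filter_imp with (2 := locally_gt 0 z Hz0). exact Gamma_euler_integral. }
  rewrite Gamma_euler_integral by lra.
  assert (Hp := euler_integral_pos z ltac:(lra)).
  assert (H := abs_Derive_euler_integral_le z ltac:(lra)).
  rewrite euler_integral_succ in H by lra.
  assert (H2 := euler_integral_succ (z - 1) ltac:(lra)).
  replace (z - 1 + 1) with z in H2 by ring.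
  assert (Hp1 := euler_integral_pos (z - 1) ltac:(lra)).
  assert (H3 := exp_ineq1_le z).
  unfold Rdiv. rewrite Rabs_mult, Rabs_inv, (Rabs_pos_eq (euler_integral z)) by lra.
  apply (Rmult_le_reg_r (euler_integral z)); [exact Hp|].
  rewrite Rmult_assoc, Rinv_l, Rmult_1_r by lra.
  nra.
Qed.

(** The lower bound for Gamma with A = exp (L + 1) gives decay at rate L + 1;
    one unit of it pays for the digamma factor. *)
Lemma rGamma_superexponential (L : R) : 0 <= L ->
  exists C, 0 <= C /\ forall z, 2 <= z ->
    Rabs (rGamma z) <= C * exp (- L * z) /\
    Rabs (digamma z / Gamma z) <= C * exp (- L * z).
Proof.
  intros HL. set (A := exp (L + 1)).
  exists (exp (A + L + 2)). split; [apply Rlt_le, exp_pos|].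
  intros z Hz.
  assert (Hlow : exp (- (A + L + 2) + (L + 1) * z) <= Gamma z).
  { rewrite Gamma_euler_integral by lra.
    apply Rle_trans with (2 := euler_integral_lower z A ltac:(lra) (exp_pos _)).
    unfold Rpower, A at 2. rewrite ln_exp, <- exp_plus. right. f_equal. ring. }
  assert (Hp : 0 < Gamma z) by (apply Rlt_le_trans with (2 := Hlow), exp_pos).
  assert (Hinv : / Gamma z <= exp (A + L + 2) * exp (- L * z) * exp (- z)).
  { replace (exp (A + L + 2) * exp (- L * z) * exp (- z))
      with (/ exp (- (A + L + 2) + (L + 1) * z)).
    - apply Rinv_le_contravar; [apply exp_pos | exact Hlow].
    - rewrite <- exp_Ropp, <- !exp_plus. f_equal. ring. }
  set (B := exp (A + L + 2) * exp (- L * z)) in *.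
  assert (HB : 0 < B) by (apply Rmult_lt_0_compat; apply exp_pos).
  assert (Hi : 0 < / Gamma z) by now apply Rinv_0_lt_compat.
  split.
  - rewrite rGamma_inv, Rabs_pos_eq by lra.
    apply Rle_trans with (1 := Hinv).
    assert (exp (- z) <= 1) by (rewrite <- exp_0; apply exp_le; lra). nra.
  - unfold Rdiv. rewrite Rabs_mult, (Rabs_pos_eq (/ Gamma z)) by lra.
    apply Rle_trans with (exp z * (B * exp (- z))).
    + apply Rmult_le_compat; try apply Rabs_pos; try lra.
      now apply abs_digamma_le.
    + right. rewrite exp_Ropp. field. apply Rgt_not_eq, exp_pos.
Qed.

(** * Series: differentiation term by term and splitting by residues *)

Lemma ex_series_eventually_le (a b : nat -> R) (K : nat) :
  (forall k, (K <= k)%nat -> Rabs (a k) <= b k) -> ex_series b -> ex_series a.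
Proof.
  intros H Hb. apply (ex_series_incr_n a K).
  apply (ex_series_le (V := R_CompleteNormedModule) _ (fun k => b (K + k)%nat)).
  - intros k. apply H. lia.
  - now apply (ex_series_incr_n b K).
Qed.

Lemma ex_series_exp (C : R) : ex_series (fun k => C * exp (- INR k)).
Proof.
  apply (ex_series_scal (V := R_NormedModule) C (fun k => exp (- INR k))).
  apply ex_series_ext with (fun k => exp (- 1) ^ k).
  - intros k. induction k as [|k IH].
    + simpl. now rewrite Ropp_0, exp_0.
    + rewrite S_INR. replace (- (INR k + 1)) with (- INR k + - 1) by ring.
      rewrite exp_plus, <- IH. simpl. ring.
  - apply ex_series_geom. rewrite Rabs_pos_eq by apply Rlt_le, exp_pos.
    rewrite <- exp_0. apply exp_increasing. lra.
Qed.

Lemma series_tail_small (M : nat -> R) (K : nat) (eps : R) :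
  ex_series M -> 0 < eps ->
  exists N, (K <= N)%nat /\ (1 <= N)%nat /\
    Series (fun k => M (N + k)%nat) < eps.
Proof.
  intros HM Heps.
  destruct (proj1 (is_series_Reals M (Series M)) (Series_correct M HM) eps Heps)
    as [n Hn].
  exists (S (Nat.max K n)). split; [lia|]. split; [lia|].
  specialize (Hn (Nat.max K n) ltac:(lia)).
  rewrite (Series_incr_n M (S (Nat.max K n))) in Hn; [|lia|exact HM].
  unfold R_dist in Hn. simpl Init.Nat.pred in Hn. apply Rabs_def2 in Hn. lra.
Qed.

Lemma Rabs_Series_le (a b : nat -> R) :
  (forall k, Rabs (a k) <= b k) -> ex_series b -> Rabs (Series a) <= Series b.
Proof.
  intros H Hb.
  assert (Ha : ex_series (fun k => Rabs (a k))).
  { apply ex_series_eventually_le with b 0%nat; [|exact Hb].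
    intros k _. now rewrite Rabs_Rabsolu. }
  apply Rle_trans with (1 := Series_Rabs a Ha).
  apply Series_le; [|exact Hb]. intros k. split; [apply Rabs_pos | apply H].
Qed.

Lemma is_derive_sum_f_R0 (f : nat -> R -> R) (d : nat -> R) (x : R) (n : nat) :
  (forall k, is_derive (f k) x (d k)) ->
  is_derive (fun y => sum_f_R0 (fun k => f k y) n) x (sum_f_R0 d n).
Proof.
  intros H. induction n as [|n IH]; simpl; [apply H|].
  apply (is_derive_plus (fun y => sum_f_R0 (fun k => f k y) n) (f (S n))); auto.
Qed.

Lemma is_derive_lipschitz (f df : R -> R) (x0 r M : R) :
  (forall x, Rabs (x - x0) < r -> is_derive f x (df x) /\ Rabs (df x) <= M) ->
  forall x, Rabs (x - x0) < r -> Rabs (f x - f x0) <= M * Rabs (x - x0).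
Proof.
  intros H x Hx. apply Rabs_def2 in Hx.
  assert (Hc : forall c, Rmin x0 x <= c <= Rmax x0 x -> Rabs (c - x0) < r).
  { intros c Hc. revert Hc. unfold Rmin, Rmax.
    destruct (Rle_dec x0 x); intros Hc; apply Rabs_def1; lra. }
  destruct (MVT_gen f x0 x df) as [c [Hc1 Hc2]].
  - intros c Hc1. apply H, Hc. lra.
  - intros c Hc1. apply continuity_pt_filterlim.
    apply (ex_derive_continuous f). exists (df c). now apply H, Hc.
  - rewrite Hc2, Rabs_mult. apply Rmult_le_compat_r; [apply Rabs_pos|].
    now apply H, Hc.
Qed.

(** Termwise differentiation.  The tail of the difference quotient is at most
    the tail of the series of M by the mean value theorem, and the finitely
    many remaining terms need to be differentiable at x0 only. *)
Lemma is_derive_Series (f df : nat -> R -> R) (M : nat -> R) (x0 r : R)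
  (K : nat) :
  0 < r ->
  (forall k, is_derive (f k) x0 (df k x0)) ->
  (forall k x, (K <= k)%nat -> Rabs (x - x0) < r ->
     is_derive (f k) x (df k x) /\ Rabs (df k x) <= M k) ->
  ex_series M -> ex_series (fun k => f k x0) ->
  is_derive (fun x => Series (fun k => f k x)) x0 (Series (fun k => df k x0)).
Proof.
  intros Hr Hd HK HM Hf.
  assert (Hr0 : Rabs (x0 - x0) < r) by (rewrite Rminus_diag, Rabs_R0; exact Hr).
  assert (Hlip : forall k x, (K <= k)%nat -> Rabs (x - x0) < r ->
            Rabs (f k x - f k x0) <= M k * Rabs (x - x0)).
  { intros k x Hk. apply (is_derive_lipschitz (f k) (df k)). intros; now apply HK. }
  assert (Hex : forall x, Rabs (x - x0) < r -> ex_series (fun k => f k x)).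
  { intros x Hx.
    apply ex_series_ext with (fun k => plus (f k x - f k x0) (f k x0)).
    { intros k. unfold plus; simpl; ring. }
    apply (ex_series_plus (V := R_NormedModule) (fun k => f k x - f k x0));
      [|exact Hf].
    apply ex_series_eventually_le with (fun k => M k * Rabs (x - x0)) K.
    - intros k Hk. now apply Hlip.
    - now apply ex_series_scal_r. }
  assert (Hexd : ex_series (fun k => df k x0)).
  { apply ex_series_eventually_le with M K; [|exact HM].
    intros k Hk. now apply HK. }
  apply is_derive_Reals. intros eps Heps.
  assert (He3 : 0 < eps / 3) by lra.
  destruct (series_tail_small M K (eps / 3) HM He3) as (N & HKN & HN & Htail).
  assert (HMN : ex_series (fun k => M (N + k)%nat)) by now apply (ex_series_incr_n M N).
  assert (Hhead := is_derive_sum_f_R0 f (fun k => df k x0) x0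
                     (Init.Nat.pred N) Hd).
  apply is_derive_Reals in Hhead. destruct (Hhead (eps / 3) He3) as [delta Hdelta].
  assert (Hm : 0 < Rmin delta r) by (apply Rmin_glb_lt; [apply cond_pos | exact Hr]).
  exists (mkposreal _ Hm). intros h Hh0 Hh. simpl in Hh.
  assert (Hh1 : Rabs h < delta) by (apply Rlt_le_trans with (1 := Hh), Rmin_l).
  assert (Hh2 : Rabs (x0 + h - x0) < r).
  { replace (x0 + h - x0) with h by ring.
    apply Rlt_le_trans with (1 := Hh), Rmin_r. }
  specialize (Hdelta h Hh0 Hh1).
  assert (Hah : 0 < Rabs h) by now apply Rabs_pos_lt.
  rewrite (Series_incr_n (fun k => f k (x0 + h)) N HN (Hex _ Hh2)).
  rewrite (Series_incr_n (fun k => f k x0) N HN Hf).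
  rewrite (Series_incr_n (fun k => df k x0) N HN Hexd).
  assert (Td : Rabs (Series (fun k => df (N + k)%nat x0)) < eps / 3).
  { apply Rle_lt_trans with (2 := Htail). apply Rabs_Series_le; [|exact HMN].
    intros k. apply HK; [lia | exact Hr0]. }
  assert (Tf : Rabs ((Series (fun k => f (N + k)%nat (x0 + h))
                      - Series (fun k => f (N + k)%nat x0)) / h) < eps / 3).
  { apply Rle_lt_trans with (2 := Htail).
    unfold Rdiv. rewrite Rabs_mult, Rabs_inv.
    apply (Rmult_le_reg_r (Rabs h)); [exact Hah|].
    rewrite Rmult_assoc, Rinv_l, Rmult_1_r by lra.
    rewrite <- Series_minus;
      [|apply (ex_series_incr_n (fun k => f k (x0 + h)) N); auto
       |apply (ex_series_incr_n (fun k => f k x0) N); auto].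
    rewrite <- Series_scal_r.
    apply Rabs_Series_le; [|now apply ex_series_scal_r].
    intros k. replace (Rabs h) with (Rabs (x0 + h - x0)) by (f_equal; ring).
    apply Hlip; [lia | exact Hh2]. }
  revert Hdelta Td Tf.
  generalize (Series (fun k => df (N + k)%nat x0)).
  generalize (Series (fun k => f (N + k)%nat (x0 + h))).
  generalize (Series (fun k => f (N + k)%nat x0)).
  generalize (sum_f_R0 (fun k => f k (x0 + h)) (Init.Nat.pred N)).
  generalize (sum_f_R0 (fun k => f k x0) (Init.Nat.pred N)).
  generalize (sum_f_R0 (fun k => df k x0) (Init.Nat.pred N)).
  intros D s0 s1 t0 t1 T H1 H2 H3.
  replace ((s1 + t1 - (s0 + t0)) / h - (D + T))
    with (((s1 - s0) / h - D) + (t1 - t0) / h + - T) by (field; exact Hh0).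
  apply Rabs_def2 in H1, H2, H3. apply Rabs_def1; lra.
Qed.

Lemma sum_n_residues (d : nat -> R) (q M : nat) : (1 <= q)%nat ->
  sum_n d (q * M + (q - 1))
    = sum_n (fun h => sum_n (fun m => d (q * m + h)%nat) M) (q - 1).
Proof.
  intros Hq.
  assert (Hb : forall M', sum_n_m d (q * M') (q * M' + (q - 1))
                 = sum_n (fun h => d (q * M' + h)%nat) (q - 1)).
  { intros M'. unfold sum_n. generalize (q - 1)%nat as p.
    induction p as [|p IH].
    - now rewrite Nat.add_0_r, !sum_n_n, Nat.add_0_r.
    - rewrite Nat.add_succ_r, !sum_n_Sm by lia. now rewrite IH, Nat.add_succ_r. }
  induction M as [|M IH].
  - rewrite Nat.mul_0_r, Nat.add_0_l. apply sum_n_ext. intros h.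
    rewrite sum_O. f_equal. lia.
  - unfold sum_n at 1. rewrite (sum_n_m_Chasles d 0 (q * M + (q - 1))) by lia.
    fold (sum_n d (q * M + (q - 1))). rewrite IH.
    replace (S (q * M + (q - 1)))%nat with (q * S M)%nat by lia.
    rewrite Hb.
    rewrite <- sum_n_plus. apply sum_n_ext. intros h. now rewrite sum_Sn.
Qed.

(** The partial sums up to complete blocks of q terms split exactly; the
    convergence of the whole series then lets M tend to infinity along them. *)
Lemma Series_residues (d l : nat -> R) (q : nat) : (1 <= q)%nat ->
  ex_series d ->
  (forall h, (h < q)%nat -> is_series (fun m => d (q * m + h)%nat) (l h)) ->
  Series d = sum_n l (q - 1).
Proof.
  intros Hq Hd Hl.
  assert (L1 : is_lim_seq (fun M => sum_n d (q * M + (q - 1))) (Series d)).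
  { apply (is_lim_seq_subseq (sum_n d) (Series d) (fun M => (q * M + (q - 1))%nat)).
    - intros U [N HN]. exists N. intros n Hn. apply HN. nia.
    - exact (Series_correct d Hd). }
  assert (L2 : forall p, (p <= q - 1)%nat ->
     is_lim_seq (fun M => sum_n (fun h => sum_n (fun m => d (q * m + h)%nat) M) p)
       (sum_n l p)).
  { induction p as [|p IH]; intros Hp.
    - rewrite sum_O.
      apply is_lim_seq_ext with (fun M => sum_n (fun m => d (q * m + 0)%nat) M).
      + intros M. now rewrite sum_O.
      + apply (Hl 0%nat). lia.
    - rewrite sum_Sn.
      apply is_lim_seq_ext with
        (fun M => sum_n (fun h => sum_n (fun m => d (q * m + h)%nat) M) p
                  + sum_n (fun m => d (q * m + S p)%nat) M).
      + intros M. now rewrite sum_Sn.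
      + apply is_lim_seq_plus'; [apply IH; lia | apply (Hl (S p)); lia]. }
  apply is_lim_seq_unique in L1.
  assert (L3 := is_lim_seq_unique _ _ (L2 (q - 1)%nat (Nat.le_refl _))).
  rewrite (Lim_seq_ext _ _ (fun M => sum_n_residues d q M Hq)) in L1.
  rewrite L3 in L1. now injection L1.
Qed.

(** * The power series of Q and P *)

(** The zeroth coefficient is digamma a, which Q leaves out. *)
Definition Q_coeff (a : R) (m : nat) : R :=
  digamma (INR m + a) / pochhammer a m.

Lemma pow_exp_le (x : R) (k : nat) : Rabs (x ^ k) <= exp (Rabs x * INR k).
Proof.
  rewrite <- RPow_abs. induction k as [|k IH].
  - simpl. rewrite Rmult_0_r, exp_0. lra.
  - rewrite S_INR, Rmult_plus_distr_l, Rmult_1_r, exp_plus, Rmult_comm. simpl.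
    apply Rmult_le_compat; try apply Rabs_pos; try exact IH.
    + apply pow_le, Rabs_pos.
    + assert (H := exp_ineq1_le (Rabs x)). lra.
Qed.

Lemma exists_nat_ge (b : R) : exists n : nat, b <= INR n.
Proof.
  destruct (INR_unbounded b) as [n Hn]. exists n. lra.
Qed.

(** Puts the coefficients in the form to which the decay of
    digamma / Gamma applies. *)
Lemma Q_coeff_Gamma (a : R) (m : nat) : ~ nonpositive_integer a ->
  Q_coeff a m = Gamma a * (digamma (a + INR m) / Gamma (a + INR m)).
Proof.
  intros Ha. unfold Q_coeff. rewrite Gamma_add, (Rplus_comm (INR m)) by exact Ha.
  assert (H1 := pochhammer_neq_0 a m Ha). assert (H2 := Gamma_neq_0 a Ha).
  now field.
Qed.

Lemma CV_radius_Q_coeff (a : R) : ~ nonpositive_integer a ->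
  CV_radius (Q_coeff a) = p_infty.
Proof.
  intros Ha.
  assert (H : forall r : R, Rbar_le r (CV_radius (Q_coeff a))).
  { intros r. apply (proj1 (Lub_Rbar_correct (CV_disk (Q_coeff a)))).
    assert (HL : 0 <= Rabs r + 1) by (assert (H := Rabs_pos r); lra).
    destruct (rGamma_superexponential _ HL) as (C & HC & HB).
    destruct (exists_nat_ge (2 - a)) as [K HK].
    apply ex_series_eventually_le with
      (fun k => Rabs (Gamma a) * C * exp (- (Rabs r + 1) * a) * exp (- INR k)) K.
    2: apply ex_series_exp.
    intros k Hk. rewrite Rabs_Rabsolu, Q_coeff_Gamma by exact Ha.
    apply le_INR in Hk.
    destruct (HB (a + INR k) ltac:(lra)) as [_ H].
    rewrite !Rabs_mult.
    apply Rle_trans with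
      (Rabs (Gamma a) * (C * exp (- (Rabs r + 1) * (a + INR k)))
       * exp (Rabs r * INR k)).
    - apply Rmult_le_compat; try apply Rabs_pos.
      + apply Rmult_le_pos; apply Rabs_pos.
      + apply Rmult_le_compat_l; [apply Rabs_pos | exact H].
      + apply pow_exp_le.
    - right.
      replace (- (Rabs r + 1) * (a + INR k))
        with (- (Rabs r + 1) * a + (- INR k + - (Rabs r * INR k))) by ring.
      rewrite !exp_plus, (exp_Ropp (Rabs r * INR k)). field.
      apply Rgt_not_eq, exp_pos. }
  destruct (CV_radius (Q_coeff a)) as [R0 | |].
  - exfalso. assert (H' := H (R0 + 1)). simpl in H'. lra.
  - reflexivity.
  - exfalso. exact (H 0).
Qed.

Lemma is_series_Q_coeff (a y : R) : ~ nonpositive_integer a ->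
  is_series (fun m => Q_coeff a m * y ^ m) (digamma a + Q a y).
Proof.
  intros Ha.
  assert (Hex : ex_series (fun m => Q_coeff a m * y ^ m)).
  { apply ex_series_Rabs. apply (CV_disk_inside (Q_coeff a) y).
    rewrite CV_radius_Q_coeff by exact Ha. exact I. }
  replace (digamma a + Q a y) with (Series (fun m => Q_coeff a m * y ^ m)).
  - now apply Series_correct.
  - rewrite Series_incr_1 by exact Hex. f_equal.
    + unfold Q_coeff. simpl. rewrite Rplus_0_l. field.
    + apply Series_ext. intros n. unfold Q_coeff, Rdiv. ring.
Qed.

Lemma Q_PSeries (a y : R) : ~ nonpositive_integer a ->
  Q a y = PSeries (Q_coeff a) y - digamma a.
Proof.
  intros Ha. unfold PSeries.
  rewrite (is_series_unique _ _ (is_series_Q_coeff a y Ha)). ring.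
Qed.

Lemma is_series_P (a y : R) : ~ nonpositive_integer a ->
  is_series (fun m => INR m * (Q_coeff a m * y ^ m)) (y * P a y).
Proof.
  intros Ha.
  assert (Hcv : Rbar_lt (Rabs y) (CV_radius (Q_coeff a)))
    by (rewrite CV_radius_Q_coeff by exact Ha; exact I).
  assert (HP : P a y = Derive (PSeries (Q_coeff a)) y).
  { unfold P.
    rewrite (Derive_ext _ (fun z => PSeries (Q_coeff a) z - digamma a))
      by (intros z; now apply Q_PSeries).
    apply is_derive_unique.
    replace (Derive (PSeries (Q_coeff a)) y)
      with (minus (Derive (PSeries (Q_coeff a)) y) 0)
      by (unfold minus, plus, opp; simpl; ring).
    apply (is_derive_minus (PSeries (Q_coeff a)) (fun _ => digamma a)).
    - now apply Derive_correct, ex_derive_PSeries.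
    - apply (is_derive_const (V := R_NormedModule)). }
  assert (H := is_pseries_incr_1 _ _ _ (is_pseries_derive (Q_coeff a) y Hcv)).
  rewrite <- HP in H.
  apply is_series_ext with (2 := H). intros m.
  rewrite pow_n_pow.
  change (y ^ m * PS_incr_1 (PS_derive (Q_coeff a)) m
          = INR m * (Q_coeff a m * y ^ m)).
  destruct m as [|m].
  - simpl. unfold zero; simpl. ring.
  - change (PS_incr_1 (PS_derive (Q_coeff a)) (S m))
      with (INR (S m) * Q_coeff a (S m)). ring.
Qed.

(** * Derivatives of the terms of the Mittag-Leffler series *)

(** With m and h the quotient and remainder of k by q, the argument is
    h/q + beta plus the natural number m, and adding m to a non-pole never
    reaches a pole. *)
Lemma nonpole_term (q : nat) (beta : R) (k : nat) : (1 <= q)%nat ->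
  (forall h, (h < q)%nat -> ~ nonpositive_integer (INR h / INR q + beta)) ->
  ~ nonpositive_integer (INR k / INR q + beta).
Proof.
  intros hq hbeta.
  assert (Hq0 : 0 < INR q) by (apply lt_0_INR; lia).
  assert (Hm := Nat.div_mod_eq k q).
  assert (Hlt := Nat.mod_upper_bound k q ltac:(lia)).
  replace (INR k / INR q + beta)
    with (INR (k mod q) / INR q + beta + INR (k / q)).
  - apply nonpole_add, hbeta, Hlt.
  - rewrite Hm at 3. rewrite plus_INR, mult_INR. field. lra.
Qed.

Definition term_derivative (x beta : R) (k : nat) (alpha : R) : R :=
  x ^ k * (INR k * - (digamma (alpha * INR k + beta) / Gamma (alpha * INR k + beta))).

Lemma is_derive_term (x beta : R) (k : nat) (alpha : R) :
  ~ nonpositive_integer (alpha * INR k + beta) ->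
  is_derive (fun al => x ^ k * rGamma (al * INR k + beta)) alpha
    (term_derivative x beta k alpha).
Proof.
  intros Hn. unfold term_derivative.
  apply (is_derive_scal (fun al => rGamma (al * INR k + beta))).
  apply (is_derive_comp rGamma (fun al => al * INR k + beta)).
  - replace (- (digamma (alpha * INR k + beta) / Gamma (alpha * INR k + beta)))
      with (- digamma (alpha * INR k + beta) / Gamma (alpha * INR k + beta))
      by (unfold Rdiv; ring).
    now apply is_derive_rGamma.
  - auto_derive; [exact I | ring].
Qed.

(** With z >= k / (2 q) - |beta| and L = 2 q (|x| + 2), the factor exp (- L z)
    beats |x|^k <= exp (|x| k) and k <= exp k and leaves exp (- k). *)
Lemma term_bounds (q : nat) (x beta : R) : (1 <= q)%nat ->
  exists (C : R) (K : nat), forall k alpha,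
  (K <= k)%nat -> / (2 * INR q) <= alpha ->
  2 <= alpha * INR k + beta /\
  Rabs (x ^ k * rGamma (alpha * INR k + beta)) <= C * exp (- INR k) /\
  Rabs (term_derivative x beta k alpha) <= C * exp (- INR k).
Proof.
  intros hq. assert (Hq0 : 0 < INR q) by (apply lt_0_INR; lia).
  set (L := 2 * INR q * (Rabs x + 2)).
  assert (Hx := Rabs_pos x).
  assert (HL : 0 <= L) by (unfold L; nra).
  destruct (rGamma_superexponential L HL) as (C & HC & HB).
  destruct (exists_nat_ge (2 * INR q * (2 + Rabs beta))) as [K HK].
  exists (C * exp (L * Rabs beta)), K. intros k alpha Hk Ha.
  apply le_INR in Hk.
  assert (Hk0 : 0 <= INR k) by apply pos_INR.
  assert (Hbeta : - Rabs beta <= beta) by (assert (H := Rle_abs (- beta));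
    rewrite Rabs_Ropp in H; lra).
  assert (Hz : INR k / (2 * INR q) - Rabs beta <= alpha * INR k + beta).
  { unfold Rdiv. nra. }
  assert (Hz2 : 2 + Rabs beta <= INR k / (2 * INR q)).
  { apply (Rmult_le_reg_l (2 * INR q)); [lra|].
    replace (2 * INR q * (INR k / (2 * INR q))) with (INR k) by (field; lra). lra. }
  assert (Hz3 : 2 <= alpha * INR k + beta) by lra.
  split; [exact Hz3|].
  destruct (HB _ Hz3) as [B1 B2].
  set (z := alpha * INR k + beta) in *.
  assert (HE : exp (Rabs x * INR k) * (exp (INR k) * (C * exp (- L * z)))
               <= C * exp (L * Rabs beta) * exp (- INR k)).
  { replace (exp (Rabs x * INR k) * (exp (INR k) * (C * exp (- L * z))))
      with (C * exp (Rabs x * INR k + INR k + - L * z))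
      by (rewrite !exp_plus; ring).
    rewrite Rmult_assoc, <- exp_plus.
    apply Rmult_le_compat_l; [exact HC|]. apply exp_le.
    assert (L * (INR k / (2 * INR q) - Rabs beta) <= L * z)
      by (apply Rmult_le_compat_l; [exact HL | exact Hz]).
    replace (L * (INR k / (2 * INR q) - Rabs beta))
      with ((Rabs x + 2) * INR k - L * Rabs beta) in H
      by (unfold L; field; lra).
    lra. }
  assert (Hek : 1 + INR k <= exp (INR k)) by apply exp_ineq1_le.
  assert (Hp := pow_exp_le x k).
  assert (HCe : 0 <= C * exp (- L * z))
    by (apply Rmult_le_pos; [exact HC | apply Rlt_le, exp_pos]).
  split.
  - rewrite Rabs_mult. apply Rle_trans with (2 := HE).
    apply Rmult_le_compat; try apply Rabs_pos; [exact Hp|]. nra.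
  - unfold term_derivative. fold z.
    rewrite !Rabs_mult, Rabs_Ropp, (Rabs_pos_eq (INR k)) by exact Hk0.
    apply Rle_trans with (2 := HE).
    apply Rmult_le_compat; try apply Rabs_pos; [|exact Hp|].
    + apply Rmult_le_pos; [exact Hk0 | apply Rabs_pos].
    + apply Rmult_le_compat; try apply Rabs_pos; try assumption. lra.
Qed.

(** Here q m + h splits the derivative into h times the series of psi + Q and
    q times the series of y P. *)
Lemma residue_series (q : nat) (x beta : R) (h : nat) : (h < q)%nat ->
  ~ nonpositive_integer (INR h / INR q + beta) ->
  is_series (fun m => term_derivative x beta (q * m + h) (1 / INR q))
    (- ((INR h * (digamma (INR h / INR q + beta)
                   + Q (INR h / INR q + beta) (x ^ q))
          + INR q * x ^ q * P (INR h / INR q + beta) (x ^ q))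
         / Gamma (INR h / INR q + beta) * x ^ h)).
Proof.
  set (a := INR h / INR q + beta). intros Hh Ha.
  assert (Hq0 : 0 < INR q) by (apply lt_0_INR; lia).
  assert (HG := Gamma_neq_0 a Ha).
  set (y := x ^ q).
  assert (H1 := is_series_scal (INR h) _ _ (is_series_Q_coeff a y Ha)).
  assert (H2 := is_series_scal (INR q) _ _ (is_series_P a y Ha)).
  assert (H3 := is_series_scal (- (x ^ h / Gamma a)) _ _
                  (is_series_plus _ _ _ _ H1 H2)).
  unfold scal, plus in H3; simpl in H3; unfold mult in H3; simpl in H3.
  replace (- ((INR h * (digamma a + Q a y) + INR q * y * P a y) / Gamma a * x ^ h))
    with (- (x ^ h / Gamma a) *
            (INR h * (digamma a + Q a y) + INR q * (y * P a y)))
    by (unfold Rdiv; ring).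
  apply is_series_ext with (2 := H3). intros m.
  rewrite Q_coeff_Gamma by exact Ha. unfold term_derivative, y.
  replace (1 / INR q * INR (q * m + h) + beta) with (a + INR m)
    by (unfold a; rewrite plus_INR, mult_INR; field; lra).
  rewrite pow_add, pow_mult, plus_INR, mult_INR.
  assert (HGm := Gamma_neq_0 _ (nonpole_add a m Ha)).
  match goal with |- ?u = ?v => change (@eq R u v) end.
  field. split; assumption.
Qed.

Theorem theorem5p3 (q : nat) (x beta : R)
  (hq : (1 <= q)%nat)
  (hbeta : forall h : nat, (h < q)%nat ->
     ~ nonpositive_integer (INR h / INR q + beta)) :
  is_derive (fun alpha : R => mittag_leffler alpha beta x) (1 / INR q)
    (- sum_n (fun h : nat =>
         (INR h * (digamma (INR h / INR q + beta)
                   + Q (INR h / INR q + beta) (x ^ q))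
          + INR q * x ^ q * P (INR h / INR q + beta) (x ^ q))
         / Gamma (INR h / INR q + beta) * x ^ h) (q - 1)).
Proof.
  assert (Hq0 : 0 < INR q) by (apply lt_0_INR; lia).
  destruct (term_bounds q x beta hq) as (C & K & HB).
  assert (Hhalf : / (2 * INR q) = 1 / INR q / 2) by (field; lra).
  assert (Hinv : 0 < 1 / INR q) by (apply Rdiv_lt_0_compat; lra).
  assert (H0 : / (2 * INR q) <= 1 / INR q) by lra.
  set (F := fun h : nat => _ / _ * _).
  assert (HS : Series (fun k => term_derivative x beta k (1 / INR q))
               = - sum_n F (q - 1)).
  { rewrite (Series_residues _ (fun h => - F h) q hq).
    - clear. unfold sum_n. generalize (q - 1)%nat. intros p.
      induction p as [|p IH].
      + now rewrite !sum_n_n.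
      + rewrite !sum_n_Sm by lia. rewrite IH. unfold plus; simpl. ring.
    - apply ex_series_eventually_le with (fun k => C * exp (- INR k)) K.
      + intros k Hk. now apply HB.
      + apply ex_series_exp.
    - intros h Hh. apply residue_series; auto. }
  rewrite <- HS. unfold mittag_leffler.
  apply (is_derive_Series (fun k alpha => x ^ k * rGamma (alpha * INR k + beta))
           (term_derivative x beta) (fun k => C * exp (- INR k))
           (1 / INR q) (1 / INR q / 2) K).
  - lra.
  - intros k. apply is_derive_term.
    replace (1 / INR q * INR k) with (INR k / INR q) by (field; lra).
    now apply (nonpole_term q beta).
  - intros k alpha Hk Halpha. apply Rabs_def2 in Halpha.
    destruct (HB k alpha Hk ltac:(lra)) as (Hz & _ & Hd).
    split; [|exact Hd]. apply is_derive_term, nonpole_pos. lra.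
  - apply ex_series_exp.
  - apply ex_series_eventually_le with (fun k => C * exp (- INR k)) K.
    + intros k Hk. now apply HB.
    + apply ex_series_exp.
Qed.
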